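(* Let $q$ be a prime power and let $r$ be an odd prime with $r\mid \frac{q-1}{2}$. Let $H_r^-$ be a cyclic subgroup of order $r$ of $G_q=\mathrm{PSL}(2,q)$ (such subgroups form a single conjugacy class). Then the intersection density of $G_q$ acting transitively by right multiplication on the right cosets of $H_r^-$ is at least $\frac{3r-1}{2r}$.
   Context: For a finite transitive permutation group $G\leq \mathrm{Sym}(\Omega)$, a subset $\mathcal{F}\subseteq G$ is intersecting if for all $g,h\in\mathcal{F}$ there is $\omega\in\Omega$ with $\omega^g=\omega^h$. The intersection density of $G$ is $\rho(G)=\max\{|\mathcal{F}| : \mathcal{F}\subseteq G \text{ intersecting}\}/(|G|/|\Omega|)$. *)

(* Defs.v *)
From mathcomp Require Import all_boot all_order all_fingroup all_algebra all_solvable.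

Set Implicit Arguments.
Unset Strict Implicit.
Unset Printing Implicit Defensive.

Import Order.TTheory GRing.Theory Num.Theory GroupScope.

Section IntersectionDensity.

Variable Omega : finType.

Definition intersecting (F : {set {perm Omega}}) : bool :=
  [forall g in F, forall h in F, exists w, g w == h w].

Definition max_intersecting (G : {set {perm Omega}}) : nat :=
  \max_(F : {set {perm Omega}} | (F \subset G) && intersecting F) #|F|.

Definition intersection_density (G : {group {perm Omega}}) : rat :=
  ((max_intersecting G)%:R / (#|G|%:R / #|Omega|%:R))%R.

End IntersectionDensity.

Section CosetAction.

Variables (gT : finGroupType) (G H : {group gT}).

Definition coset_space : finType := {A : {set gT} | A \in rcosets H G}.

(* 'Rs is the action A |-> A :* g on subsets of gT; here it is restricted to
   the right cosets H :* x with x in G. *)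
Definition coset_action := subaction coset_space 'Rs.

(* The permutation group on the coset space induced by G. *)
Definition coset_perm_group : {group {perm coset_space}} :=
  (actperm coset_action @* G)%G.

(* The domain of the restricted action contains G, so that the morphic image
   above is the image of all of G. *)
Lemma sub_coset_action_dom : G \subset subact_dom (fun A => A \in rcosets H G) 'Rs.
Proof.
apply/subsetP=> g Gg; rewrite !inE; apply/subsetP=> A; rewrite !inE /=.
case/rcosetsP=> x Gx ->; rewrite rcosetE -rcosetM.
by apply/rcosetsP; exists (x * g) => //; rewrite groupM.
Qed.

End CosetAction.

Section PSL2.

Variable F : finFieldType.

Definition SL2_set : {set {'GL_2[F]}} := [set u | (\det (GLval u) == 1)%R].

Lemma SL2_group_set : group_set SL2_set.
Proof.
apply/group_setP; split=> [|u v]; first by rewrite inE GL_1E det1.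
by rewrite !inE GL_ME det_mulmx => /eqP-> /eqP->; rewrite mulr1.
Qed.

Definition SL2 : {group {'GL_2[F]}} := Group SL2_group_set.

Definition PSL2 : {group coset_of 'Z(SL2)} := (SL2 / 'Z(SL2))%G.

End PSL2.

(* Main.v *)
(* Lift everything to SL(2,q), where a matrix with the trace w + w^-1 of a
   diagonalizable element of order r is conjugate to diag(w, w^-1).  Take three
   points of the projective line and, for each of the three pairs of them, the
   cyclic group of order r fixing that pair; orient the pairs cyclically, so
   that each point is attracting for one group and repelling for another.  With
   M_c(x) the element of the c-th group having eigenvalues x, x^-1, the matrices
   M_c(x) M_d(y)^-1 with c <> d are triangular in a suitable basis and have
   eigenvalues xy, (xy)^-1.  Hence the identity together with the M_c(w^i),
   1 <= i <= (r-1)/2, have pairwise quotients conjugate to nontrivial elements of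
   H, since 0 < i + j < r.  This intersecting family has 1 + 3(r-1)/2
   elements. *)
Require Import Defs.
From mathcomp Require Import all_boot all_order all_fingroup all_algebra all_solvable.
From mathcomp Require Import ring.
Set Implicit Arguments.
Unset Strict Implicit.
Import Order.TTheory GRing.Theory Num.Theory GroupScope.

(** * Coset actions and their intersecting families *)

Lemma coset_actE (gT : finGroupType) (G H : {group gT})
    (g : gT) (w : coset_space G H) :
  g \in G -> val (actperm (coset_action G H) g w) = val w :* g.
Proof.
move=> Gg; rewrite actpermE /= val_subact /= rcosetE.
by rewrite (subsetP (sub_coset_action_dom G H)).
Qed.

Lemma card_coset_space (gT : finGroupType) (G H : {group gT}) :
  #|coset_space G H| = #|G : H|.
Proof. by rewrite card_sig; apply: eq_card => A; rewrite !inE. Qed.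

(* A nontrivial kernel of the coset action would make H normal, hence all
   quotients lie in H, contradicting #|H| < #|T|; so f stays injective in the
   permutation group. *)
Lemma max_intersecting_coset_ge (gT : finGroupType) (G H : {group gT})
    (T : finType) (f : T -> gT) :
  H \subset G -> prime #|H| -> (#|H| < #|T|)%N ->
  (forall t, f t \in G) ->
  (forall t t', t != t' -> exists2 x, x \in G & f t * (f t')^-1 \in H^# :^ x) ->
  (#|T| <= max_intersecting (coset_perm_group G H))%N.
Proof.
move=> sHG pH ltHT Gf quo_f.
pose p t := actperm (coset_action G H) (f t).
have coset_in x : x \in G -> H :* x \in rcosets H G.
  by move=> Gx; rewrite -rcosetE imset_f.
pose w x Gx : coset_space G H := exist (fun A => A \in rcosets H G) (H :* x) (coset_in x Gx).
have Gquo t t' : f t * (f t')^-1 \in G by rewrite groupM ?groupV.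
have p_inj : injective p.
  move=> t t' eq_p; apply/eqP/negP => /negP neq_tt'.
  set g := f t * (f t')^-1.
  have fix_g x : x \in G -> g \in H :^ x.
    move=> Gx; have := congr1 (fun s : {perm _} => val (s (w x Gx))) eq_p.
    rewrite /p !coset_actE //= => eq_x.
    rewrite mem_conjg conjgE invgK.
    have : x * f t \in H :* x :* f t' by rewrite -eq_x -rcosetM rcoset_refl.
    by rewrite -rcosetM !mem_rcoset !invMg !mulgA.
  have Hg : g \in H by rewrite -[gval H]conjsg1 fix_g.
  have ntg : g != 1.
    have [x _] := quo_f t t' neq_tt'; rewrite conjD1g => /setD1P[] //.
  (* Since [#|H|] is prime, [g] generates [H], so every conjugate of [H] containing [g] is [H]
     itself. *)
  have defH : <[g]> = H.
    apply/eqP; rewrite eqEcard cycle_subG Hg /= -orderE.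
    have := order_dvdG Hg; move/primeP: pH => [_ dv] /dv /orP[] /eqP o_g; last by rewrite o_g.
    by move: ntg; rewrite -order_eq1 o_g.
  have nH x : x \in G -> H :^ x = H.
    move=> Gx; apply/eqP; rewrite eq_sym eqEcard cardJg leqnn andbT.
    by rewrite -{1}defH cycle_subG fix_g.
  pose h t1 := f t1 * (f t)^-1.
  have Hh t1 : h t1 \in H.
    have [-> | /quo_f[x Gx]] := eqVneq t1 t; rewrite /h; first by rewrite mulgV group1.
    by rewrite conjD1g nH // => /setD1P[].
  have h_inj : injective h.
    move=> t1 t2 /mulIg eq_f; apply/eqP/negP => /negP /quo_f[x _].
    by rewrite eq_f mulgV conjD1g !inE eqxx.
  have : (#|[set h t1 | t1 in T]| <= #|H|)%N.
    by apply: subset_leq_card; apply/subsetP=> _ /imsetP[t1 _ ->].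
  by rewrite card_imset // leqNgt ltHT.
rewrite -(card_imset _ p_inj).
apply: (@leq_bigmax_cond _ _ (fun F : {set {perm _}} => #|F|)).
apply/andP; split.
  apply/subsetP=> _ /imsetP[t _ ->]; apply: mem_morphim => //=.
  exact: (subsetP (sub_coset_action_dom G H)).
apply/'forall_implyP=> _ /imsetP[t _ ->].
apply/'forall_implyP=> _ /imsetP[t' _ ->]; apply/existsP.
have [<- | neq_tt'] := eqVneq t t'; first by exists (w 1 (group1 G)).
have [x Gx] := quo_f t t' neq_tt'; rewrite conjD1g => /setD1P[_ Hg].
(* The two permutations agree at the coset of [x] exactly when the quotient lies in [H :^ x]. *)
exists (w x Gx); rewrite -val_eqE !coset_actE //=.
rewrite -!rcosetM; apply/eqP/rcoset_eqP; rewrite mem_rcoset invMg.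
by move: Hg; rewrite mem_conjg conjgE invgK !mulgA.
Qed.

(** The permutation group is an image of [G], so its order is at most [#|G : H| * #|H|]; the
    denominator of the density is thus at most [#|H|]. *)
Lemma intersection_density_coset_ge (gT : finGroupType) (G H : {group gT})
    (n : nat) :
  H \subset G -> (n <= max_intersecting (coset_perm_group G H))%N ->
  (n%:R / #|H|%:R <= intersection_density (coset_perm_group G H) :> rat)%R.
Proof.
move=> sHG le_n; rewrite /intersection_density card_coset_space.
set P := coset_perm_group G H.
have leP : (#|P| <= #|G : H| * #|H|)%N.
  by rewrite mulnC Lagrange // leq_morphim.
have ltr0 (m : nat) : (0 < m)%N -> (0 < m%:R :> rat)%R by rewrite ltr0n.
have [P0 H0 I0] : [/\ 0 < #|P|, 0 < #|H| & 0 < #|G : H|]%N by rewrite !cardG_gt0.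
rewrite invf_div; apply: ler_pM; rewrite ?ler0n ?invr_ge0 ?ler_nat ?ler0n //.
rewrite ler_pdivlMr ?ltr0 // mulrC ler_pdivrMr ?ltr0 //.
by rewrite -natrM ler_nat.
Qed.

Local Open Scope ring_scope.

(** * Two by two matrices and diagonalization *)

Definition mx2 (F : fieldType) (a b c d : F) : 'M[F]_2 :=
  \matrix_(i, j) if i == 0 then if j == 0 then a else b
                 else if j == 0 then c else d.

Lemma mx2_eta (F : fieldType) (M : 'M[F]_2) :
  M = mx2 (M 0 0) (M 0 1) (M 1 0) (M 1 1).
Proof.
apply/matrixP; case=> [[|[|//]] i] [[|[|//]] j]; rewrite !mxE /=;
  by congr (M _ _); apply: val_inj.
Qed.

Lemma mul_mx2 (F : fieldType) (a b c d a' b' c' d' : F) :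
  mx2 a b c d *m mx2 a' b' c' d' =
  mx2 (a * a' + b * c') (a * b' + b * d') (c * a' + d * c') (c * b' + d * d').
Proof.
apply/matrixP; case=> [[|[|//]] i] [[|[|//]] j];
  by rewrite !mxE !big_ord_recl big_ord0 !mxE /= addr0.
Qed.

Lemma mx2_1 (F : fieldType) : mx2 1 0 0 1 = 1%:M :> 'M[F]_2.
Proof. by apply/matrixP; case=> [[|[|//]] i] [[|[|//]] j]; rewrite !mxE. Qed.

Lemma det_mx2 (F : fieldType) (a b c d : F) :
  \det (mx2 a b c d) = a * d - b * c.
Proof.
rewrite (expand_det_row _ 0) !big_ord_recl big_ord0 /cofactor !det_mx11 !mxE /=.
by rewrite expr0 expr1 mul1r mulN1r mulrN addr0.
Qed.

Lemma tr_mx2 (F : fieldType) (a b c d : F) : \tr (mx2 a b c d) = a + d.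
Proof. by rewrite /mxtrace !big_ord_recl big_ord0 !mxE /= addr0. Qed.

Lemma diagonalize_mx2 (F : fieldType) (M : 'M[F]_2) (z : F) :
  z != 0 -> z ^+ 2 != 1 -> \det M = 1 -> \tr M = z + z^-1 ->
  exists2 P : 'M[F]_2, \det P = 1 & P *m M = mx2 z 0 0 z^-1 *m P.
Proof.
move=> z0 z2; rewrite (mx2_eta M); move: (M 0 0) (M 0 1) (M 1 0) (M 1 1) => a b c d.
rewrite det_mx2 tr_mx2 => detM trM.
have zz : z - z^-1 != 0.
  by apply: contra z2; rewrite subr_eq0 => /eqP e; rewrite expr2 {1}e mulVf.
suff [P P0 defP] : exists2 P : 'M[F]_2, \det P != 0 &
    P *m mx2 a b c d = mx2 z 0 0 z^-1 *m P.
  (* Rescaling the second row of [P] normalizes its determinant and commutes with the diagonal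
     matrix. *)
  exists (mx2 1 0 0 (\det P)^-1 *m P).
    by rewrite det_mulmx det_mx2 !mul1r mulr0 subr0 mulVf.
  rewrite -mulmxA defP !mulmxA; congr (_ *m P); rewrite !mul_mx2.
  by congr mx2; ring.
have dE : d = z + z^-1 - a by rewrite -trM addrC addKr.
have zV : z * z^-1 = 1 by rewrite mulfV.
have bcE : b * c = a * d - z * z^-1 by rewrite zV -detM opprB addrC subrK.
have qE : (a - z) * (a - z^-1) = - (b * c) by rewrite bcE dE; ring.
(* The rows of [P] are left eigenvectors for [z] and [z^-1], read off from a nonzero off-diagonal
   entry; if there is none, [M] is already diagonal and at most a swap is needed. *)
have [c0 | c0] := eqVneq c 0; last first.
  exists (mx2 c (z - a) c (z^-1 - a)).
    rewrite det_mx2 (_ : _ - _ = - (c * (z - z^-1))); last by ring.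
    by rewrite oppr_eq0 mulf_neq0.
  rewrite !mul_mx2; congr mx2; rewrite ?(mulrC c b) ?bcE ?dE; ring.
have [b0 | b0] := eqVneq b 0; last first.
  exists (mx2 (z - d) b (z^-1 - d) b).
    rewrite det_mx2 (_ : _ - _ = b * (z - z^-1)); last by ring.
    by rewrite mulf_neq0.
  rewrite !mul_mx2; congr mx2; rewrite ?bcE ?dE; ring.
move: qE; rewrite b0 mul0r oppr0 => /eqP; rewrite mulf_eq0 !subr_eq0.
case/orP => /eqP aE.
  exists (mx2 1 0 0 1); first by rewrite det_mx2 !mulr1 mulr0 subr0 oner_eq0.
  rewrite !mul_mx2; congr mx2; rewrite ?dE ?aE ?c0; ring.
exists (mx2 0 1 1 0); first by rewrite det_mx2 mulr0 mulr1 sub0r oppr_eq0 oner_eq0.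
rewrite !mul_mx2; congr mx2; rewrite ?dE ?aE ?c0; ring.
Qed.

(** * The three cyclic groups of the triangle *)

(* The three points are spanned by the column vectors e1, e2 and e1 + e2; the
   eigenvectors for x and x^-1 are, in turn, (e1, e2), (e2, e1 + e2) and
   (e1 + e2, e1). *)
Definition triangle_mx (F : fieldType) (c : 'I_3) (x : F) : 'M[F]_2 :=
  match val c with
  | 0%N => mx2 x 0 0 x^-1
  | 1%N => mx2 x^-1 0 (x^-1 - x) x
  | _ => mx2 x^-1 (x - x^-1) 0 x
  end.

Lemma det_triangle_mx (F : fieldType) c (x : F) :
  x != 0 -> \det (triangle_mx c x) = 1.
Proof.
by move=> x0; rewrite /triangle_mx; case: c => [[|[|[|//]]] /= _];
  rewrite det_mx2 ?mulr0 ?mul0r subr0 ?mulfV ?mulVf.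
Qed.

Lemma triangle_mxM (F : fieldType) c (x y : F) :
  x != 0 -> y != 0 ->
  triangle_mx c x *m triangle_mx c y = triangle_mx c (x * y).
Proof.
by move=> x0 y0; rewrite /triangle_mx; case: c => [[|[|[|//]]] /= _];
  rewrite mul_mx2; congr mx2; field; rewrite ?x0 ?y0.
Qed.

Lemma tr_triangle_mx (F : fieldType) c (x : F) :
  \tr (triangle_mx c x) = x + x^-1.
Proof.
by rewrite /triangle_mx; case: c => [[|[|[|//]]] /= _]; rewrite tr_mx2 // addrC.
Qed.

(** The eigenvector shared by the two factors has eigenvalues [x] and [y], or [x^-1] and [y^-1],
    because of the cyclic orientation; determinant 1 gives the other eigenvalue of the product. *)
Lemma tr_triangle_mxM (F : fieldType) c d (x y : F) :
  x != 0 -> y != 0 -> c != d ->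
  \tr (triangle_mx c x *m triangle_mx d y^-1) = x * y + (x * y)^-1.
Proof.
move=> x0 y0; rewrite /triangle_mx.
case: c d => [[|[|[|//]]] /= ?] [[|[|[|//]]] /= ?]; rewrite //= => _;
  rewrite mul_mx2 tr_mx2; field; rewrite ?x0 ?y0 ?oner_eq0 //.
Qed.

(** * Roots of unity and traces of elements of order r *)

Lemma prim_root_prime (F : fieldType) (r : nat) (z : F) :
  prime r -> z ^+ r = 1 -> z != 1 -> r.-primitive_root z.
Proof.
move=> pr zr z1; have [m zm dvd_m] := prim_order_exists (prime_gt0 pr) zr.
have /primeP[_ /(_ m dvd_m)/orP[] /eqP m_r] := pr; last by rewrite -m_r.
by move: (prim_expr_order zm) z1; rewrite m_r expr1 => ->; rewrite eqxx.
Qed.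

Lemma finField_prim_root (F : finFieldType) (r : nat) :
  prime r -> (r %| #|F|.-1)%N -> exists z : F, r.-primitive_root z.
Proof.
move=> pr; rewrite -card_finField_unit => dvd_r.
have [u _ o_u] := Cauchy pr dvd_r; exists (val u); apply: prim_root_prime => //.
  by rewrite -FinRing.val_unitX -o_u expg_order.
apply/eqP=> u1; have : u = 1%g by apply: val_inj.
by move/eqP; rewrite -order_eq1 o_u => /eqP r1; rewrite r1 in pr.
Qed.

Lemma tr_mx2_prim_root (F : finFieldType) (r : nat) (M : 'M[F]_2) :
  prime r -> (r %| #|F|.-1)%N -> \det M = 1 -> M ^+ r = 1 -> M != 1 ->
  exists2 w : F, r.-primitive_root w & \tr M = w + w^-1.
Proof.
move=> pr dvd_r detM Mr ntM.
have [z z_prim] := finField_prim_root pr dvd_r.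
have [i i_r deti] :
    exists2 i : 'I_r, (0 < i)%N & \det (M - (z ^+ i)%:M) = 0.
  (* M is a root of 'X^r - 1 = \prod_i ('X - z ^+ i), so if no eigenvalue were
     different from 1 then M would be 1. *)
  have [/existsP[i /andP[i0 /eqP deti]] | ] :=
    boolP [exists i : 'I_r, (0 < i)%N && (\det (M - (z ^+ i)%:M) == 0)].
    by exists i.
  rewrite negb_exists => /forallP no_i.
  case/eqP: ntM; apply/eqP; rewrite -subr_eq0.
  pose N := \prod_(1 <= i < r) (M - (z ^+ i)%:M).
  have uN : N \is a GRing.unit.
    rewrite /N big_seq; apply: rpred_prod => i.
    rewrite mem_index_iota => /andP[i0 i_r].
    have := no_i (Ordinal i_r); rewrite /= i0 /=.
    by rewrite -unitfE -unitmxE.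
  have : (M - 1) * N = 0.
    have := congr1 (horner_mx M) (factor_Xn_sub_1 z_prim).
    rewrite rmorph_prod rmorphB rmorphXn rmorph1 /= horner_mx_X Mr subrr.
    rewrite big_ltn ?prime_gt0 // => prod0; rewrite -[RHS]prod0; congr (_ * _).
      by rewrite rmorphB /= horner_mx_X horner_mx_C expr0.
    by apply: eq_bigr => i _; rewrite rmorphB /= horner_mx_X horner_mx_C.
  by move/(canRL (mulrK uN)); rewrite mul0r => ->.
have w_nz : z ^+ i != 0 by rewrite expf_neq0 // (prim_root_eq0 z_prim) -lt0n prime_gt0.
exists (z ^+ i).
  apply: prim_root_prime => //.
    by rewrite exprAC (prim_expr_order z_prim) expr1n.
  by rewrite -(prim_order_dvd z_prim) gtnNdvd.
(* With [\det M = 1], the characteristic equation at [w] reads [w * \tr M = w * w + 1]. *)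
move: detM deti; rewrite (mx2_eta M); move: (M 0 0) (M 0 1) (M 1 0) (M 1 1) => a b c d.
move: (z ^+ i) w_nz => w w_nz.
have -> : w%:M = mx2 w 0 0 w by rewrite (mx2_eta w%:M) !mxE.
have -> : mx2 a b c d - mx2 w 0 0 w = mx2 (a - w) b c (d - w).
  rewrite [LHS]mx2_eta; congr mx2; rewrite !mxE /= ?subr0 //.
rewrite !det_mx2 tr_mx2 => detM det0; apply: (mulfI w_nz).
rewrite [RHS]mulrDr mulfV // -detM; apply/eqP; rewrite -subr_eq0 -oppr_eq0 -det0.
by apply/eqP; ring.
Qed.

(** * Conjugacy and centre in SL(2,q) *)

Lemma SL2_lift (F : finFieldType) (M : 'M[F]_2) :
  \det M = 1 -> exists2 g : {'GL_2[F]}, g \in SL2 F & GLval g = M.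
Proof.
move=> detM; have uM : M \is a GRing.unit by rewrite -[_ \is a _]unitmxE unitmxE detM unitr1.
by exists (FinRing.unit _ uM); rewrite // inE /= detM.
Qed.

Lemma diagonalize_SL2 (F : finFieldType) (u : {'GL_2[F]}) (z : F) :
  u \in SL2 F -> z != 0 -> z ^+ 2 != 1 -> \tr (GLval u) = z + z^-1 ->
  exists2 g, g \in SL2 F & GLval (g * u * g^-1)%g = mx2 z 0 0 z^-1.
Proof.
rewrite inE => /eqP detu z0 z2 tru.
have [P detP defP] := @diagonalize_mx2 _ (GLval u) z z0 z2 detu tru.
have [g SLg gP] := SL2_lift detP; exists g => //.
rewrite GL_ME GL_ME GL_VE gP; apply: (canLR (mulrK _)); last exact: defP.
by rewrite -gP GL_unit.
Qed.

Lemma GLvalX (F : finFieldType) (u : {'GL_2[F]}) k :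
  GLval (u ^+ k)%g = GLval u ^+ k.
Proof. exact: FinRing.val_unitX. Qed.

Lemma diag_mx2X (F : fieldType) (z : F) k :
  (mx2 z 0 0 z^-1 : 'M[F]_2) ^+ k = mx2 (z ^+ k) 0 0 (z ^+ k)^-1.
Proof.
elim: k => [|k IHk]; first by rewrite !expr0 invr1 mx2_1.
rewrite exprS IHk [LHS]mul_mx2.
by rewrite !mul0r !mulr0 !addr0 !add0r -exprS -!exprVn -exprS.
Qed.

(** Diagonalizing [v] and [u] inside SL(2,q) turns both [v ^+ k] and [u] into the diagonal matrix of
    [w ^+ k] and its inverse. *)
Lemma SL2_conj_expg (F : finFieldType) (v u : {'GL_2[F]}) (w : F) k :
  v \in SL2 F -> u \in SL2 F -> w != 0 -> w ^+ 2 != 1 -> (w ^+ k) ^+ 2 != 1 ->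
  \tr (GLval v) = w + w^-1 -> \tr (GLval u) = w ^+ k + (w ^+ k)^-1 ->
  exists2 x, x \in SL2 F & u = ((v ^+ k) ^ x)%g.
Proof.
move=> SLv SLu w0 w2 wk2 trv tru.
have [g SLg gv] := diagonalize_SL2 SLv w0 w2 trv.
have [h SLh hu] := diagonalize_SL2 SLu (expf_neq0 k w0) wk2 tru.
exists (g^-1 * h)%g; first by rewrite groupM ?groupV.
have : (h * u * h^-1 = (v ^+ k) ^ g^-1)%g.
  apply: val_inj; rewrite [LHS]hu conjXg [RHS]GLvalX.
  by rewrite conjgE invgK mulgA gv diag_mx2X.
by move=> e; rewrite conjgM -e conjgE !mulgA mulVg mul1g mulgKV.
Qed.

(** Commuting with the two elementary transvections forces a scalar matrix, whose square is its
    determinant times the identity. *)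
Lemma center_SL2_sqr (F : finFieldType) (u : {'GL_2[F]}) :
  u \in 'Z(SL2 F)%g -> (u ^+ 2 = 1)%g.
Proof.
case/centerP; rewrite inE => /eqP detu cu.

have comm M : \det M = 1 -> GLval u *m M = M *m GLval u.
  by case/SL2_lift=> g SLg <-; rewrite -!GL_MxE cu.
have := comm (mx2 1 1 0 1); have := comm (mx2 1 0 1 1).
rewrite !det_mx2 !mulr0 !mul0r !mulr1 !subr0 => /(_ erefl) comL /(_ erefl) comU.
apply: val_inj; rewrite [LHS]GLvalX expr2 -[LHS]/(GLval u *m GLval u).
move: detu comL comU; rewrite (mx2_eta (GLval u)).
move: (GLval u 0 0) (GLval u 0 1) (GLval u 1 0) (GLval u 1 1) => a b c d.
rewrite det_mx2 !mul_mx2 !mulr1 !mulr0 !mul1r !mul0r !addr0 !add0r => detu.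
have entries (x y z t x' y' z' t' : F) : mx2 x y z t = mx2 x' y' z' t' ->
    x = x' /\ y = y'.
  by move/matrixP=> e; move: (e 0 0) (e 0 1); rewrite !mxE.
move=> /entries[/eqP + _] /entries[/eqP + /eqP].
rewrite -subr_eq0 addrAC subrr add0r => /eqP b0.
rewrite -subr_eq0 opprD addNKr oppr_eq0 => /eqP c0.
rewrite b0 c0 addr0 add0r => /eqP ad.
move: detu; rewrite b0 c0 ad ?mulr0 ?mul0r ?addr0 ?add0r subr0 => ->.
by rewrite mx2_1.
Qed.

(** * The triangle family and its quotients *)

(** Exponents subtract within one cyclic group and add across two; as both are at most [r./2], the
    sum stays below [r] and a difference vanishes modulo [r] only if they are equal. *)
Lemma triangle_quotient (F : finFieldType) (r : nat) (w : F)
    (c d : 'I_3) (i j : nat) :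
  odd r -> r.-primitive_root w -> (i < r./2.+1)%N -> (j < r./2.+1)%N ->
  (if c == d then i != j else (0 < i + j)%N) ->
  exists2 k, ~~ (r %| k)%N &
    \tr (triangle_mx c (w ^+ i) *m triangle_mx d (w ^+ j)^-1) =
    w ^+ k + (w ^+ k)^-1.
Proof.
move=> r_odd wr; rewrite !ltnS => le_i le_j.
have r_gt0 := prim_order_gt0 wr.
have w0 : w != 0 by rewrite (prim_root_eq0 wr) -lt0n.
have wX n : w ^+ n != 0 by rewrite expf_neq0.
have defr : (r./2 + r./2 < r)%N.
  by rewrite addnn -{2}(odd_double_half r) r_odd.
case: eqVneq => [<- neq_ij | neq_cd ij_gt0]; last first.
  exists (i + j)%N; last by rewrite tr_triangle_mxM // exprD.
  by rewrite gtnNdvd // (leq_ltn_trans (leq_add le_i le_j)).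
have lt_j : (j < r)%N by rewrite (leq_ltn_trans _ defr) // (leq_trans le_j) ?leq_addr.
have lt_i : (i < r)%N by rewrite (leq_ltn_trans _ defr) // (leq_trans le_i) ?leq_addr.
have wXr : w ^+ (r - j) = (w ^+ j)^-1.
  by apply: (mulIf (wX j)); rewrite mulVf // -exprD subnK ?(prim_expr_order wr) // ltnW.
(* A natural number representing [i - j] modulo [r]. *)
exists (i + (r - j))%N; last by rewrite triangle_mxM ?invr_eq0 // tr_triangle_mx exprD wXr.
rewrite (prim_order_dvd wr) exprD wXr; apply: contra neq_ij => /eqP wij.
have : w ^+ i = w ^+ j by rewrite -[RHS]mul1r -wij mulfVK.
by move/eqP; rewrite (eq_prim_root_expr wr) !modn_small.
Qed.

Section TriangleFamily.

Variables (F : finFieldType) (h : nat) (w : F).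

(** [None] stands for the identity: its exponent is 0, so the choice of vertex 0 is immaterial. *)
Definition triangle_vertex (t : option ('I_3 * 'I_h)) : 'I_3 :=
  if t is Some (c, _) then c else 0.

(** The shift reserves exponent 0 for [None], so the identity is not repeated in each cyclic
    group. *)
Definition triangle_exp (t : option ('I_3 * 'I_h)) : nat :=
  if t is Some (_, i) then i.+1 else 0.

(** Invertibility of the matrix needs [w != 0]; the default 1 is never reached under that
    condition. *)
Definition triangle_SL2 (t : option ('I_3 * 'I_h)) : {'GL_2[F]} :=
  odflt 1%g [pick g : {'GL_2[F]} | GLval g ==
    triangle_mx (triangle_vertex t) (w ^+ triangle_exp t)].

Lemma GLval_triangle_SL2 t : w != 0 ->
  GLval (triangle_SL2 t) =
  triangle_mx (triangle_vertex t) (w ^+ triangle_exp t).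
Proof.
move=> w0; rewrite /triangle_SL2; case: pickP => [g /eqP // | no_g].
have [g _ defg] := SL2_lift (det_triangle_mx (triangle_vertex t)
  (expf_neq0 (triangle_exp t) w0)).
by have := no_g g; rewrite defg eqxx.
Qed.

Lemma triangle_SL2_in t : w != 0 -> triangle_SL2 t \in SL2 F.
Proof.
by move=> w0; rewrite inE GLval_triangle_SL2 // det_triangle_mx ?expf_neq0.
Qed.

Lemma GLval_triangle_SL2V t : w != 0 ->
  GLval (triangle_SL2 t)^-1%g =
  triangle_mx (triangle_vertex t) (w ^+ triangle_exp t)^-1.
Proof.
move=> w0; have wX : w ^+ triangle_exp t != 0 by rewrite expf_neq0.
have := GL_unit (triangle_SL2 t); rewrite GL_VE GLval_triangle_SL2 //.
set M := triangle_mx _ _ => uM; apply: (mulrI uM); rewrite mulrV //.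
rewrite [RHS]triangle_mxM ?invr_eq0 // mulfV // /triangle_mx.
by case: triangle_vertex => [[|[|[|//]]] /= _]; rewrite invr1 ?subrr ?mx2_1.
Qed.

End TriangleFamily.

Lemma triangle_SL2_conj (F : finFieldType) (r h : nat) (w : F)
    (v : {'GL_2[F]}) (t t' : option ('I_3 * 'I_h)) :
  prime r -> r = h.*2.+1 -> r.-primitive_root w ->
  v \in SL2 F -> \tr (GLval v) = w + w^-1 -> t != t' ->
  exists k x, [/\ ~~ (r %| k)%N, x \in SL2 F
    & (triangle_SL2 w t * (triangle_SL2 w t')^-1 = (v ^+ k) ^ x)%g].
Proof.
move=> pr r_h wr SLv trv neq_tt'.
have r_odd : odd r by rewrite r_h /= odd_double.
have w0 : w != 0 by rewrite (prim_root_eq0 wr) -lt0n prime_gt0.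
have half_r : r./2 = h by rewrite r_h /= uphalf_double.
(* Since [r] is odd, squaring kills no nontrivial power of [w], so the eigenvalues are distinct. *)
have ndvd2 k : ~~ (r %| k)%N -> (w ^+ k) ^+ 2 != 1.
  rewrite -exprM -(prim_order_dvd wr) Gauss_dvdl //.
  by rewrite coprimen2.
have exp_lt (s : option ('I_3 * 'I_h)) : (triangle_exp s < r./2.+1)%N.
  by rewrite half_r; case: s => [[c i]|] //=; rewrite ltnS.
have [|k ndvd_k trk] := triangle_quotient (c := triangle_vertex t)
    (d := triangle_vertex t') r_odd wr (exp_lt t) (exp_lt t').
  (* Distinct indices at one vertex have distinct exponents; at two vertices they are not both
     [None], so the exponents have a positive sum. *)
  case: t t' neq_tt' {exp_lt} => [[c i]|] [[d j]|] neq_tt' //=; try by case: ifP.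
  by case: ifP => [/eqP cd | _] //; apply: contra neq_tt'; rewrite cd => /eqP[/val_inj->].
have w1 : w ^+ 2 != 1.
  by rewrite -[w]expr1 ndvd2 // dvdn1 gtn_eqF // prime_gt1.
have [x SLx defx] : exists2 x, x \in SL2 F &
    (triangle_SL2 w t * (triangle_SL2 w t')^-1 = (v ^+ k) ^ x)%g.
  apply: (SL2_conj_expg SLv _ w0 w1 (ndvd2 k ndvd_k) trv).
    by rewrite groupM ?groupV ?triangle_SL2_in.
  by rewrite GL_ME GLval_triangle_SL2V // GLval_triangle_SL2 // [LHS]trk.
by exists k, x.
Qed.

(** * Descent to PSL(2,q) and the lower bound *)

(* The lift of a generator is squared to land in the r-th roots of 1 rather than
   of the central elements +-1. *)
Lemma PSL2_prime_generator (F : finFieldType) (r : nat)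
    (H : {group coset_of 'Z(SL2 F)%g}) :
  prime r -> odd r -> (r %| #|F|.-1)%N -> H \subset PSL2 F -> #|H| = r ->
  exists v w, [/\ v \in SL2 F, r.-primitive_root w, \tr (GLval v) = w + w^-1,
    coset 'Z(SL2 F)%g v \in H & #[coset 'Z(SL2 F)%g v]%g = r].
Proof.
move=> pr r_odd dvd_r sHG oH.
have [y Hy oy] : {y | y \in H & #[y]%g = r} by apply: Cauchy; rewrite ?oH.
have /morphimP[u nZu SLu defy] := subsetP sHG y Hy.
have oy2 : #[y ^+ 2]%g = r.
  by rewrite orderXgcd oy (eqP (_ : coprime r 2)) ?divn1 // coprimen2.
have cv : coset 'Z(SL2 F)%g (u ^+ 2)%g = (y ^+ 2)%g by rewrite defy -morphX.
have SLv : (u ^+ 2)%g \in SL2 F by rewrite groupX.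
have vr : (u ^+ 2 ^+ r = 1)%g.
  rewrite expgAC center_SL2_sqr // coset_idr ?groupX //.
  by rewrite morphX //= -defy -oy expg_order.
have [|||w wr trw] := @tr_mx2_prim_root F r (GLval (u ^+ 2)) pr dvd_r.
- by move: SLv; rewrite inE => /eqP.
- by rewrite -GLvalX vr.
- apply/eqP=> v1; have u2 : (u ^+ 2 = 1)%g by apply: val_inj.
  by move: oy2; rewrite -cv u2 morph1 order1 => r1; rewrite -r1 in pr.
by exists (u ^+ 2)%g, w; rewrite cv oy2; split=> //; rewrite groupX.
Qed.

Local Close Scope ring_scope.

Theorem theorem4p1 (q : nat) (F : finFieldType) (cardF : #|F| = q)
    (r : nat) (r_prime : prime r) (r_odd : odd r)
    (q_odd : odd q) (r_dvd : (r %| (q - 1) %/ 2)%N)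
    (H : {group coset_of 'Z(SL2 F)})
    (sHG : H \subset PSL2 F) (cycH : cyclic H) (cardH : #|H| = r) :
  ((3 * r%:R - 1) / (2 * r%:R) <=
     intersection_density (coset_perm_group (PSL2 F) H) :> rat)%R.
Proof.
have r_dvd1 : (r %| #|F|.-1)%N.
  rewrite cardF -subn1 -(@divnK 2 (q - 1)) ?dvdn_mulr //.
  by rewrite dvdn2 subn1 -oddS prednK // odd_gt0.
have [v [w [SLv wr trv Hv ov]]] :=
  PSL2_prime_generator r_prime r_odd r_dvd1 sHG cardH.
have w0 : (w != 0)%R by rewrite (prim_root_eq0 wr) -lt0n prime_gt0.
have r_h : r = (r./2).*2.+1 by rewrite -[LHS]odd_double_half r_odd.
set h := r./2 in r_h.
have h_gt0 : (0 < h)%N by case: h r_h (prime_gt1 r_prime) => // ->.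
pose T := option ('I_3 * 'I_h).
have cardT : #|{: T}| = (3 * h).+1 by rewrite card_option card_prod !card_ord.
have nZ x : x \in SL2 F -> x \in 'N('Z(SL2 F)).
  by apply/subsetP; exact: normal_norm (center_normal _).
have SLt t := triangle_SL2_in (h := h) t w0.
have le_max : (#|{: T}| <= max_intersecting (coset_perm_group (PSL2 F) H))%N.
  apply: (@max_intersecting_coset_ge _ _ _ _
    (fun t => coset 'Z(SL2 F) (triangle_SL2 w t))) => //.
  - by rewrite cardH.
  - rewrite cardT cardH r_h ltnS -mul2n ltn_pmul2r //.
  - by move=> t; apply: mem_quotient.
  move=> t t' /(triangle_SL2_conj r_prime r_h wr SLv trv)[k [x [ndvd_k SLx def_x]]].
  exists (coset 'Z(SL2 F) x); first exact: mem_quotient.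
  rewrite -morphV ?nZ // -morphM ?groupV ?nZ // [(_ * _)%g]def_x.
  (* The image of [v] has order [r] in [H], so its [k]-th power is a nontrivial element of [H]. *)
  rewrite morphJ ?groupX ?nZ // morphX ?nZ // memJ_conjg !inE groupX // andbT.
  by rewrite -order_dvdn ov.
have := intersection_density_coset_ge sHG le_max.
(* For [r = 2 * h + 1], [3 * r - 1 = 2 * (3 * h + 1)], so the two bounds coincide. *)
apply: le_trans; rewrite cardT cardH r_h -mul2n.
rewrite le_eqVlt; apply/orP; left; apply/eqP.
rewrite -!natr1 !natrM -!natr1 !mulr0n.
by field; rewrite -natrM natr1 pnatr_eq0.
Qed.
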